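(* Fix an integer $b\ge1$ and let $f=f_b$ be the complexity function of jammed configurations of Rydberg atoms with blockade range $b$, i.e. $f(\rho)=\lim_{L\to\infty}\frac{\ln J_{\lfloor\rho L\rfloor,L}}{L}$ where $J_{N,L}$ is the number of jammed configurations of length $L$ with exactly $N$ ones. Then the density $\rho_\star^{b\text{-Ryd}}$ at which $f$ attains its maximum is $$\rho_\star^{b\text{-Ryd}}=\frac{(1-z)(1-z^{b+1})}{1+b-bz-2z^{b+1}-2bz^{b+1}+z^{b+2}+2bz^{b+2}},$$ where $z$ is the unique root in $(0,1)$ of the polynomial $z^{2b+1}+\dots+z^{b+2}+z^{b+1}-1$.
   Context: A configuration of length $L$ is a word in $\{0,1\}^L$ ($1$ = excited Rydberg atom, $0$ = neutral atom). With blockade range $b\ge1$, a configuration is jammed if any two ones are separated by at least $b$ zeros and no zero can be turned into a one while preserving this; equivalently (for nonempty words) it contains at least one $1$, consecutive ones are separated by between $b$ and $2b$ zeros, and the leading and trailing runs of zeros have length at most $b$. The complexity is set to $0$ at densities where there are no configurations. It is known that for $\frac1{2b+1}<\rho\le\frac1{b+1}$, $f(\rho)=\rho\big[-\ln\frac{1-z}{1-z^{b+1}}-(\frac1\rho-(b+1))\ln z\big]$ with $z\ge0$ the real root of $\sum_{i=0}^b(i+b+1-\frac1\rho)z^i$ maximizing this expression, and $f(\rho)=0$ otherwise. *)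

(* Defs.v *)
From mathcomp Require Import all_boot all_order all_algebra.
From mathcomp Require Import all_classical all_reals all_analysis.
Set Implicit Arguments.
Unset Strict Implicit.
Unset Printing Implicit Defensive.
Import Order.TTheory GRing.Theory Num.Theory.
Import numFieldNormedType.Exports.
Local Open Scope ring_scope.

Definition configuration (L : nat) := (L.-tuple bool)%type.

Definition zeros_between L (w : configuration L) (i j : 'I_L) : {set 'I_L} :=
  [set k : 'I_L | (i < k < j)%N & ~~ tnth w k]%SET.

Definition blockaded (b L : nat) (w : configuration L) : bool :=
  [forall i : 'I_L, forall j : 'I_L,
    [&& (i < j)%N, tnth w i & tnth w j] ==> (b <= #|zeros_between w i j|)%N].

Definition excite L (w : configuration L) (i : 'I_L) : configuration L :=
  [tuple (k == i) || tnth w k | k < L].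

Definition jammed (b L : nat) (w : configuration L) : bool :=
  blockaded b w && [forall i : 'I_L, ~~ tnth w i ==> ~~ blockaded b (excite w i)].

Definition nb_ones L (w : configuration L) : nat := #|[set i | tnth w i]%SET|.

Definition J (b N L : nat) : nat :=
  #|[set w : configuration L | jammed b w & nb_ones w == N]%SET|.

(* Num.truncn is the integer part on nonnegative reals.  When there is no
   jammed configuration the term is 0, because ln 0 = 0 in the library: this is
   the convention that the complexity vanishes where there are no
   configurations. *)
Definition complexity_seq (R : realType) (b : nat) (rho : R) : nat -> R :=
  fun L => ln (J b (Num.truncn (rho * L%:R)) L)%:R / L%:R.

Definition complexity (R : realType) (b : nat) (rho : R) : R :=
  limn (complexity_seq b rho).

Definition rydberg_poly (R : realType) (b : nat) : {poly R} :=
  (\sum_(b.+1 <= k < (2 * b + 1).+1) 'X^k) - 1.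

Definition rho_star (R : realType) (b : nat) (z : R) : R :=
  ((1 - z) * (1 - z ^+ (b + 1))) /
  (1 + b%:R - b%:R * z - 2 * z ^+ (b + 1) - 2 * b%:R * z ^+ (b + 1)
   + z ^+ (b + 2) + 2 * b%:R * z ^+ (b + 2)).

(* Main.v *)
Require Import Defs.
From mathcomp Require Import all_boot all_order all_algebra.
From mathcomp Require Import all_classical all_reals all_analysis.
From mathcomp Require Import zify ring lra.
Import Order.TTheory GRing.Theory Num.Theory.
Import numFieldNormedType.Exports.
Local Open Scope ring_scope.

(** A jammed word is determined by its leading and trailing runs of zeros and by the excesses
    over b of its gaps, all in {0, ..., b}; hence J b N L is the coefficient of x^(L + b - N(b+1))
    in q(x)^(N+1), where q(x) = 1 + x + ... + x^b.  Coefficients of powers of q are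
    log-concave, so tilting by a suitable x > 0 makes any given one the largest, and
    [x^m] q(x)^n equals inf_x q(x)^n x^(-m) up to a factor b n + 1.  Therefore f(rho) is the
    infimum over x of rho ln q(x) - (1 - rho (b+1)) ln x when 1/(2b+1) < rho <= 1/(b+1), and 0
    otherwise.  At the root z, z^(b+1) q(z) = 1, so this expression is -ln z at x = z whatever
    rho is; z minimizes it exactly when rho (b + 1 + z q'(z)/q(z)) = 1, that is rho = rho_star,
    and for every other rho the infimum is smaller. *)

(** * Jammed words *)

Definition spaced (b : nat) (u : seq bool) : Prop :=
  forall i j : nat, (i < j)%N -> nth false u i -> nth false u j -> (i + b < j)%N.

(** Maximality of a spaced word: a site with no one within distance b could still be excited. *)
Definition covered (b : nat) (u : seq bool) : Prop :=
  forall k : nat, (k < size u)%N ->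
    exists j : nat, [/\ nth false u j, (k <= j + b)%N & (j <= k + b)%N].

Lemma nth_true_lt_size (u : seq bool) (i : nat) :
  nth false u i -> (i < size u)%N.
Proof. by case: ltnP => // le_ui; rewrite nth_default. Qed.

Lemma blockadedP (b L : nat) (w : configuration L) :
  blockaded b w <-> spaced b w.
Proof.
split.
- move=> /forallP bw i j lt_ij wi wj.
  have iL := nth_true_lt_size _ _ wi; have jL := nth_true_lt_size _ _ wj.
  rewrite size_tuple in iL jL.
  move/forallP: (bw (Ordinal iL)) => /(_ (Ordinal jL)).
  rewrite !(tnth_nth false) /= lt_ij wi wj /=.
  set A := zeros_between _ _ _ => leb.
  have : (size (map val (enum A)) <= size (iota i.+1 (j - i.+1)))%N.
    apply: uniq_leq_size; first by rewrite map_inj_uniq ?enum_uniq //; exact: val_inj.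
    move=> x /mapP[k]; rewrite mem_enum inE /= => /andP[/andP[ik kj] _] ->.
    by rewrite mem_iota; lia.
  by rewrite size_map -cardE size_iota => /(leq_trans leb); lia.
- move=> sw; apply/forallP => i; apply/forallP => j; apply/implyP.
  rewrite !(tnth_nth false) => /and3P[lt_ij wi wj].
  have ltb := sw _ _ lt_ij wi wj.
  (* The b sites right after [i] precede [j] and are zeros: a one among them would be too close to
     [i]. *)
  rewrite cardE -(size_map val) -[X in (X <= _)%N](size_iota i.+1 b).
  apply: uniq_leq_size; first exact: iota_uniq.
  move=> x; rewrite mem_iota => xb.
  have xL : (x < L)%N by have := ltn_ord j; lia.
  apply/mapP; exists (Ordinal xL) => //.
  rewrite mem_enum inE /= (tnth_nth false) /=; apply/andP; split; first by lia.
  apply/negP => wx; have := sw i x _ wi wx; lia.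
Qed.

Lemma nth_excite (L : nat) (w : configuration L) (k : 'I_L) (i : nat) :
  nth false (excite w k) i = (i == k) || nth false w i.
Proof.
case: (ltnP i L) => [iL|Li].
  by rewrite -[i in LHS]/(val (Ordinal iL)) -tnth_nth tnth_mktuple (tnth_nth false).
rewrite !nth_default ?size_tuple //; have := ltn_ord k; lia.
Qed.

Lemma jammedP (b L : nat) (w : configuration L) :
  jammed b w <-> spaced b w /\ covered b w.
Proof.
split.
- move=> /andP[/blockadedP sw /forallP nw]; split=> // k.
  rewrite size_tuple => kL; apply: contrapT => nk.
  have wk : ~~ nth false w k.
    by apply/negP => wk; apply: nk; exists k; split => //; lia.
  move: (nw (Ordinal kL)); rewrite (tnth_nth false) wk /= => /negP; apply.
  apply/blockadedP => i j lt_ij; rewrite !nth_excite /=.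
  case/orP => [/eqP ei | wi]; case/orP => [/eqP ej | wj].
  + by move: lt_ij; rewrite ei ej ltnn.
  + by rewrite ei ltnNge; apply/negP => ?; apply: nk; exists j; split => //; lia.
  + by rewrite ltnNge; apply/negP => ?; apply: nk; exists i; split => //; lia.
  + exact: sw.
- move=> [sw cw]; apply/andP; split; first exact/blockadedP.
  apply/forallP => k; apply/implyP; rewrite (tnth_nth false) => wk.
  apply/negP => /blockadedP se.
  have [|j [wj kj jk]] := cw k; first by rewrite size_tuple.
  have ek : nth false (excite w k) k by rewrite nth_excite eqxx.
  have ej : nth false (excite w k) j by rewrite nth_excite wj orbT.
  case: (ltngtP k j) => [lt_kj|lt_jk|e_kj].
  + by have := se _ _ lt_kj ek ej; lia.
  + by have := se _ _ lt_jk ej ek; lia.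
  + by move: wk; rewrite e_kj wj.
Qed.

Lemma nb_onesE (L : nat) (w : configuration L) : nb_ones w = count id w.
Proof.
by rewrite /nb_ones -sum1dep_card -sum1_count big_tuple.
Qed.

(* The number [d] of zeros read since the last one is the state of a
   deterministic automaton accepting the continuations of 1 0^d. *)
Fixpoint jam_from (b d : nat) (w : seq bool) : bool :=
  match w with
  | [::] => (d <= b)%N
  | true :: w' => (b <= d)%N && jam_from b 0 w'
  | false :: w' => (d < 2 * b)%N && jam_from b d.+1 w'
  end.

Lemma nth_one_zeros_cat (d : nat) (w : seq bool) (i : nat) :
  nth false (true :: nseq d false ++ w) i =
  (i == 0%N) || (d < i)%N && nth false w (i - d.+1).
Proof.
case: i => [|i] //=; rewrite nth_cat size_nseq nth_nseq.
by rewrite if_same ltnS subSS; case: ltnP.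
Qed.

(** Each one starts afresh: earlier letters matter only through the gap [d], whose sites are all
    covered exactly when [d] is at most 2b. *)
Lemma jam_fromP (b d : nat) (w : seq bool) : (d <= 2 * b)%N ->
  jam_from b d w <-> spaced b (true :: nseq d false ++ w) /\
                     covered b (true :: nseq d false ++ w).
Proof.
elim: w d => [|[] w IH] d led /=.
- split.
  + move=> db; split.
      by move=> i j ij; rewrite !nth_one_zeros_cat !(nth_nil false); lia.
    move=> k; rewrite /= size_cat size_nseq /= addn0 => kd; exists 0%N.
    by rewrite nth_one_zeros_cat; split => //; lia.
  + move=> [_ /(_ d)]; rewrite /= size_cat size_nseq /= addn0.
    by case=> // j []; rewrite nth_one_zeros_cat (nth_nil false); lia.
- have E i : nth false (true :: nseq d false ++ true :: w) (d.+1 + i) =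
             nth false (true :: w) i.
    by rewrite nth_one_zeros_cat addKn addSn ltnS leq_addr.
  split.
  + move=> /andP[bd /IH [//|/= sw cw]]; split.
      move=> i j ij.
      case: (ltnP d j) => dj; last first.
        by rewrite !nth_one_zeros_cat; lia.
      have -> : j = (d.+1 + (j - d.+1))%N by lia.
      case: (ltnP d i) => di.
        have -> : i = (d.+1 + (i - d.+1))%N by lia.
        by rewrite !E => wi wj; have := sw (i - d.+1)%N (j - d.+1)%N; rewrite wi wj; lia.
      by rewrite nth_one_zeros_cat; lia.
    move=> k; rewrite /= size_cat size_nseq /= => kd.
    case: (ltnP b k) => bk; last first.
      by exists 0%N; rewrite nth_one_zeros_cat; split => //; lia.
    case: (ltnP d k) => dk; last first.
      exists (d.+1 + 0)%N; rewrite E /=; split => //; lia.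
    have [|j [wj kj jk]] := cw (k - d.+1)%N; first by rewrite /=; lia.
    by exists (d.+1 + j)%N; rewrite E; split => //; lia.
  + move=> [sw cw].
    have bd : (b <= d)%N.
      have := sw 0%N (d.+1 + 0)%N; rewrite E /=; lia.
    rewrite bd /=; apply/IH => //=; split.
      by move=> i j ij wi wj; have := sw (d.+1 + i)%N (d.+1 + j)%N; rewrite !E wi wj; lia.
    move=> k /= kw; case: (ltnP b k) => bk; last first.
      by exists 0%N; split => //; lia.
    have [|j [wj kj jk]] := cw (d.+1 + k)%N.
      by rewrite /= size_cat size_nseq /=; lia.
    exists (j - d.+1)%N; split; [rewrite -E | lia | lia].
    by have -> : (d.+1 + (j - d.+1) = j)%N by lia.
- have E : nseq d false ++ false :: w = nseq d.+1 false ++ w.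
    by rewrite -addn1 nseqD -catA.
  rewrite E; case: ltnP => db /=; first exact: IH.
  (* Here [d] is 2b, so a further zero leaves site b+1 uncovered: sites 1 to 2b+1 are all zeros. *)
  split=> // -[_ /(_ b.+1)]; rewrite /= size_cat size_nseq => -[|j []].
    by lia.
  by rewrite (nth_one_zeros_cat d.+1); lia.
Qed.

(** A virtual one followed by b zeros is put before the word: it is far enough to respect the
    spacing and too far to cover any site of the word. *)
Lemma jammed_jam_from (b L : nat) (w : configuration L) :
  jammed b w = jam_from b b w.
Proof.
apply/idP/idP.
- move/jammedP => [sw cw]; apply/jam_fromP; first lia.
  split.
    move=> i j ij; rewrite !nth_one_zeros_cat.
    case/orP => [/eqP ei|/andP[bi wi]]; case/orP => [/eqP ej|/andP[bj wj]]; try lia.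
    have := sw (i - b.+1)%N (j - b.+1)%N; rewrite wi wj; lia.
  move=> k; rewrite /= size_cat size_nseq => kd.
  case: (ltnP b k) => bk; last first.
    by exists 0%N; split => //; lia.
  have [|j [wj kj jk]] := cw (k - b.+1)%N; first lia.
  exists (b.+1 + j)%N; split; try lia.
  by rewrite nth_one_zeros_cat addKn wj addSn ltnS leq_addr.
- move/jam_fromP => [|sw cw]; first lia.
  apply/jammedP; split.
    move=> i j ij wi wj; have := sw (b.+1 + i)%N (b.+1 + j)%N.
    rewrite !nth_one_zeros_cat.
    have -> : (b.+1 + j - b.+1 = j)%N by lia.
    have -> : (b.+1 + i - b.+1 = i)%N by lia.
    by rewrite wi wj; lia.
  move=> k kw; have [|j [wj kj jk]] := cw (b.+1 + k)%N.
    by rewrite /= size_cat size_nseq; lia.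
  exists (j - b.+1)%N; move: wj; rewrite nth_one_zeros_cat.
  case/orP => [/eqP j0|/andP[bj wj]]; first lia.
  by split => //; lia.
Qed.

(* [window_coef b n m] is the coefficient of x^m in (1 + x + ... + x^b)^n;
   integer indices make it vanish below 0 without side conditions. *)
Fixpoint window_coef (b n : nat) (m : int) : nat :=
  if n is n'.+1 then (\sum_(t < b.+1) window_coef b n' (m - t%:Z))%N
  else (m == 0).

Lemma window_coef_lt0 (b n : nat) (m : int) : m < 0 -> window_coef b n m = 0%N.
Proof.
elim: n m => [|n IH] m m0 /=; first by case: eqP => // ?; lia.
by rewrite big1 // => t _; apply: IH; lia.
Qed.

Lemma sum_tuple_cons (T : finType) (L : nat) (F : L.+1.-tuple T -> nat) :
  (\sum_(w : L.+1.-tuple T) F w)%N =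
  (\sum_(x : T) \sum_(w : L.-tuple T) F [tuple of x :: w])%N.
Proof.
rewrite pair_bigA /=.
rewrite (reindex (fun p : T * L.-tuple T => [tuple of p.1 :: p.2])) //=.
exists (fun w : L.+1.-tuple T => (thead w, [tuple of behead w])).
- by move=> [x w] _; congr pair; apply: val_inj.
- by move=> w _; rewrite [w in RHS]tuple_eta; apply: val_inj.
Qed.

(** With b zeros appended, the trailing run obeys the same bounds b and 2b as a gap. [g] is the full
    length of the run in progress, and the index left over is the total excess of the [N] later
    runs. *)
Lemma sum_jam_from (b d N L : nat) : (d <= 2 * b)%N ->
  (\sum_(w : L.-tuple bool) (jam_from b d w && (count id w == N)))%N =
  (\sum_(maxn b d <= g < (2 * b).+1)
    window_coef b N (L%:Z + d%:Z + b%:Z - (N * b.+1)%:Z - g%:Z))%N.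
Proof.
elim: L d N => [|L IH] d N led.
- rewrite (bigD1 [tuple]) //= [X in (_ + X)%N]big1 ?addn0; last first.
    by move=> w; rewrite [w]tuple0.
  case: N => [|N]; last first.
    rewrite andbF big_nat_cond big1 // => g /andP[/andP[bg _] _].
    by apply: window_coef_lt0; rewrite geq_max in bg; nia.
  rewrite eqxx andbT; case: leqP => db.
    rewrite (big_cat_nat (n := (b + d)%N)) ?(big_ltn (m := (b + d)%N)) /=; try lia.
    rewrite (_ : _ == _); last by apply/eqP; lia.
    rewrite [X in (X + _)%N]big_nat_cond [X in (X + _)%N]big1; last first.
      by move=> g /andP[/andP[g1 g2] _]; case: eqP => // e; lia.
    rewrite [X in (_ + (_ + X))%N]big_nat_cond [X in (_ + (_ + X))%N]big1 //.
    by move=> g /andP[/andP[g1 g2] _]; case: eqP => // e; lia.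
  by rewrite big_nat_cond big1 // => g /andP[/andP[bg dg] _] /=; case: eqP => // e; lia.
- rewrite sum_tuple_cons big_bool /=.
  (* A one closes the run, giving the term [g = d]; a zero gives the terms with [g > d]. *)
  rewrite [X in (X + _)%N](_ : _ = if (b <= d)%N then
      window_coef b N (L.+1%:Z + d%:Z + b%:Z - (N * b.+1)%:Z - d%:Z) else 0%N); last first.
    case: leqP => bd /=; last by rewrite big1.
    case: N => [|N].
      rewrite big1 => [|w _]; last by rewrite add1n andbF.
      by rewrite /=; case: eqP => //; lia.
    rewrite (eq_bigr (fun w : L.-tuple bool =>
      (jam_from b 0 w && (count id w == N)) : nat)) => [|w _]; last by rewrite add1n eqSS.
    rewrite IH // maxn0 -{1}[b in LHS]add0n big_addn.
    rewrite (_ : (2 * b).+1 - b = b.+1)%N ?big_mkord /=; last lia.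
    by apply: eq_bigr => t _; congr window_coef; lia.
  rewrite [X in (_ + X)%N](_ : _ = \sum_(maxn b d.+1 <= g < (2 * b).+1)
      window_coef b N (L.+1%:Z + d%:Z + b%:Z - (N * b.+1)%:Z - g%:Z))%N; last first.
    case: ltnP => db /=; last by rewrite big1 // big_geq //; lia.
    rewrite (eq_bigr (fun w : L.-tuple bool =>
      (jam_from b d.+1 w && (count id w == N)) : nat)) //.
    by rewrite IH //; apply: eq_bigr => g _; congr window_coef; lia.
  case: leqP => bd.
    rewrite (maxn_idPr (leqW bd)).
    by rewrite [in RHS]big_ltn.
  by rewrite (maxn_idPl bd).
Qed.

(** Starting in state b, the leading run also contributes an excess [g - b], hence the exponent
    N+1. *)
Lemma J_window_coef (b N L : nat) :
  J b N L = window_coef b N.+1 (L%:Z + b%:Z - (N * b.+1)%:Z).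
Proof.
rewrite /J -sum1dep_card big_mkcond /=.
rewrite (eq_bigr (fun w : L.-tuple bool =>
  (jam_from b b w && (count id w == N)) : nat)) => [|w _]; last first.
  by rewrite jammed_jam_from nb_onesE; case: (_ && _).
rewrite sum_jam_from; last lia.
rewrite maxnn -{1}[b in LHS]add0n big_addn.
rewrite (_ : (2 * b).+1 - b = b.+1)%N ?big_mkord /=; last lia.
by apply: eq_bigr => t _; congr window_coef; lia.
Qed.

(** * Coefficients of powers of 1 + x + ... + x^b *)

Lemma window_coef_gt0 (b n : nat) (m : int) :
  0 <= m <= (b * n)%:Z -> (0 < window_coef b n m)%N.
Proof.
elim: n m => [|n IH] m /= hm; first by rewrite (_ : m == 0) //; lia.
(* The truncated difference is the least t for which m - t does not exceed b n. *)
have lt : (`|m| - b * n < b.+1)%N by nia.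
rewrite (bigD1 (Ordinal lt)) //= addn_gt0; apply/orP; left.
by apply: IH; lia.
Qed.

Lemma window_coef_eq0 (b n : nat) (m : int) :
  (b * n)%:Z < m -> window_coef b n m = 0%N.
Proof.
elim: n m => [|n IH] m hm /=; first by case: eqP => // ?; lia.
by rewrite big1 // => t _; apply: IH; have := ltn_ord t; lia.
Qed.

(** The leading coefficient of q(x)^n is 1. At low density this leaves at most one jammed word. *)
Lemma window_coef_le1 (b n : nat) (m : int) :
  (b * n)%:Z <= m -> (window_coef b n m <= 1)%N.
Proof.
elim: n m => [|n IH] m hm /=; first by case: eqP.
rewrite big_ord_recr /= big1 ?add0n; first by apply: IH; lia.
by move=> t _; apply: window_coef_eq0; have := ltn_ord t; lia.
Qed.

(** The pair (i, j+r) moves inward one unit at a time; once i reaches j both sides agree by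
    symmetry. Assuming log-concavity for all i <= j handles sequences with zeros. *)
Lemma log_concave_shift (a : int -> nat) (i j : int) (r : nat) :
  (forall i j : int, i <= j -> (a i * a (j + 1)%R <= a (i + 1)%R * a j)%N) ->
  i <= j -> (a i * a (j + r%:Z)%R <= a (i + r%:Z)%R * a j)%N.
Proof.
move=> aLC; elim: r i => [|r IH] i ij; first by rewrite !addr0.
have [->|nij] := eqVneq i j; first by rewrite mulnC.
have -> : i + r.+1%:Z = i + 1 + r%:Z by lia.
have -> : j + r.+1%:Z = j + r%:Z + 1 by lia.
apply: leq_trans (IH (i + 1) _); last lia.
by apply: aLC; lia.
Qed.

(** For the window sum S, S(m+1) - S(m) = a(m+1) - a(m-b), so the claim splits into S(i) a(j+1) <=
    a(i+1) S(j) and a(i-b) S(j) <= S(i) a(j-b), both termwise instances of the shift. *)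
Lemma log_concave_window_sum (a : int -> nat) (b : nat) (i j : int) :
  (forall i j : int, i <= j -> (a i * a (j + 1)%R <= a (i + 1)%R * a j)%N) ->
  i <= j ->
  ((\sum_(t < b.+1) a (i - t%:Z)%R) * (\sum_(t < b.+1) a (j + 1 - t%:Z)%R) <=
   (\sum_(t < b.+1) a (i + 1 - t%:Z)%R) * (\sum_(t < b.+1) a (j - t%:Z)%R))%N.
Proof.
move=> aLC ij; set S := fun m : int => (\sum_(t < b.+1) a (m - t%:Z)%R)%N.
rewrite -/(S i) -/(S j) -/(S (i + 1)) -/(S (j + 1)).
have Srec (m : int) : (S (m + 1)%R + a (m - b%:Z)%R = S m + a (m + 1)%R)%N.
  rewrite /S big_ord_recl big_ord_recr /= subr0.
  rewrite (eq_bigr (fun t : 'I_b => a (m - t%:Z))) => [|t _]; first lia.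
  by congr a; rewrite /bump; lia.
have up : (S i * a (j + 1)%R <= a (i + 1)%R * S j)%N.
  rewrite /S big_distrl big_distrr; apply: leq_sum => t _ /=.
  have := @log_concave_shift a (i - t%:Z) (j - t%:Z) t.+1 aLC.
  have -> : i - t%:Z + t.+1%:Z = i + 1 by lia.
  have -> : j - t%:Z + t.+1%:Z = j + 1 by lia.
  by apply; lia.
have down : (a (i - b%:Z)%R * S j <= S i * a (j - b%:Z)%R)%N.
  rewrite /S big_distrl big_distrr; apply: leq_sum => t _ /=.
  have := @log_concave_shift a (i - b%:Z) (j - b%:Z) (b - t) aLC.
  have tb := ltn_ord t.
  have -> : i - b%:Z + (b - t)%N%:Z = i - t%:Z by lia.
  have -> : j - b%:Z + (b - t)%N%:Z = j - t%:Z by lia.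
  by apply; lia.
by have := Srec i; have := Srec j; nia.
Qed.

Lemma window_coef_log_concave (b n : nat) (i j : int) : i <= j ->
  (window_coef b n i * window_coef b n (j + 1)%R <=
   window_coef b n (i + 1)%R * window_coef b n j)%N.
Proof.
elim: n i j => [|n IH] i j ij /=; last exact: log_concave_window_sum.
by case: (i =P 0) => // i0; case: (j + 1 =P 0) => // j0; lia.
Qed.

(* The value q(x) at [x = expR s]. *)
Definition partition_sum (R : realType) (b : nat) (s : R) : R :=
  \sum_(i < b.+1) expR (s * i%:R).

Lemma partition_sum_ge1 (R : realType) (b : nat) (s : R) : 1 <= partition_sum R b s.
Proof.
rewrite /partition_sum big_ord_recl mulr0 expR0 lerDl.
by apply: sumr_ge0 => i _; exact: expR_ge0.
Qed.

Lemma partition_sum_ge_expR (R : realType) (b : nat) (s : R) :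
  expR (s * b%:R) <= partition_sum R b s.
Proof.
rewrite /partition_sum big_ord_recr /= lerDr.
by apply: sumr_ge0 => i _; exact: expR_ge0.
Qed.

Lemma partition_sum_gt0 (R : realType) (b : nat) (s : R) : 0 < partition_sum R b s.
Proof. exact: lt_le_trans (partition_sum_ge1 _ _ _). Qed.

Lemma window_coef_upper (R : realType) (b n : nat) (m : int) (s : R) :
  (window_coef b n m)%:R * expR (s * m%:~R) <= partition_sum R b s ^+ n.
Proof.
elim: n m => [|n IH] m /=.
  by case: eqP => [->|_]; rewrite ?mulr0 ?expR0 ?mulr1 ?mul0r //.
rewrite exprSr /partition_sum mulr_sumr natr_sum mulr_suml.
apply: ler_sum => t _; apply: le_trans (ler_wpM2r (expR_ge0 _) (IH (m - t%:Z))).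
by rewrite -mulrA -expRD intrB -mulrDr subrK.
Qed.

(** The cutoff [K] is free so that the induction hypothesis applies to [K - t], the range left after
    a shift by t. *)
Lemma sum_window_coef (R : realType) (b n K : nat) (s : R) : (b * n < K)%N ->
  \sum_(0 <= m < K) (window_coef b n m%:Z)%:R * expR (s * m%:R) =
  partition_sum R b s ^+ n.
Proof.
elim: n K => [|n IH] K hK.
  rewrite big_ltn ?(leq_ltn_trans _ hK) //= mulr0 expR0 mulr1 big_nat_cond big1 ?addr0 //.
  by move=> m /andP[/andP[m0 _] _]; case: eqP => [|_]; [lia | rewrite mul0r].
rewrite exprSr /partition_sum mulr_sumr.
transitivity (\sum_(0 <= m < K) \sum_(t < b.+1)
    ((window_coef b n (m%:Z - t%:Z))%:R * expR (s * (m%:R - t%:R))) * expR (s * t%:R)).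
  apply: eq_bigr => m _; rewrite /= natr_sum mulr_suml; apply: eq_bigr => t _.
  by rewrite -mulrA -expRD -mulrDr subrK.
rewrite exchange_big /=; apply: eq_bigr => t _; rewrite -mulr_suml; congr (_ * _).
have tb := ltn_ord t.
rewrite (big_cat_nat (n := t)) /=; [|lia|nia].
rewrite big_nat_cond big1 ?add0r; last first.
  by move=> m /andP[/andP[_ mt] _]; rewrite window_coef_lt0 ?mul0r //; lia.
rewrite -{1}[nat_of_ord t]add0n big_addn -(IH (K - t)%N); last by nia.
apply: eq_bigr => m _; rewrite natrD addrK.
by have -> : (m + t)%N%:Z - t%:Z = m%:Z by lia.
Qed.

(* The tilt [expR s = a_m / a_(m+1)] makes [m] the mode of the log-concave
   sequence [a_k * expR (s * k)], whose b * n + 1 terms add up to [partition_sum ^+ n]. *)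
Lemma window_coef_lower (R : realType) (b n m : nat) : (m < b * n)%N ->
  exists s : R, partition_sum R b s ^+ n <=
    (b * n).+1%:R * ((window_coef b n m%:Z)%:R * expR (s * m%:R)).
Proof.
move=> mn; set a := fun k : nat => (window_coef b n k%:Z)%:R : R.
have a0 : 0 < a m by rewrite ltr0n window_coef_gt0 //; lia.
(* The strict bound on [m] keeps the denominator of the tilt nonzero. *)
have a1 : 0 < a m.+1 by rewrite ltr0n window_coef_gt0 //; lia.
have aLC i j : (i <= j)%N -> a i * a j.+1 <= a i.+1 * a j.
  move=> ij; rewrite -!natrM ler_nat.
  have := @window_coef_log_concave b n i%:Z j%:Z.
  have -> : i%:Z + 1 = i.+1%:Z by lia.
  have -> : j%:Z + 1 = j.+1%:Z by lia.
  by apply; lia.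
pose s := ln (a m / a m.+1); exists s.
have es : expR s = a m / a m.+1 by rewrite lnK // posrE divr_gt0.
have step k : expR (s * k.+1%:R) = expR (s * k%:R) * (a m / a m.+1).
  by rewrite -es -expRD -natr1 mulrDr mulr1.
have mode k : a k * expR (s * k%:R) <= a m * expR (s * m%:R).
  have [mk|km] := leqP m k.
    rewrite -(subnKC mk); elim: (k - m)%N => [|d IH]; first by rewrite addn0.
    apply: le_trans IH; rewrite addnS step.
    rewrite mulrA mulrAC ler_pM2r ?expR_gt0 // mulrA ler_pdivrMr //.
    by rewrite mulrC [leRHS]mulrC aLC // leq_addr.
  have : (m - k <= m)%N by exact: leq_subr.
  rewrite -{2 3}(subKn (ltnW km)); elim: (m - k)%N => [|d IH dm]; first by rewrite subn0.
  apply: le_trans (IH (ltnW dm)); rewrite -(subnSK dm) step.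
  rewrite [leRHS]mulrA [leRHS]mulrAC ler_pM2r ?expR_gt0 //.
  by rewrite mulrA ler_pdivlMr // aLC // leq_subr.
rewrite -(@sum_window_coef R b n (b * n).+1 s) //.
apply: le_trans (_ : \sum_(0 <= k < (b * n).+1) (a m * expR (s * m%:R)) <= _).
  by apply: ler_sum => k _; exact: mode.
by rewrite sumr_const_nat subn0 mulr_natl.
Qed.

(** * Exponential growth rate *)

(** The rate per site of ln (q(x)^(N+1) x^(-m)), with m = L + b - N(b+1), N close to rho L and s =
    ln x. *)
Definition free_energy (R : realType) (b : nat) (rho s : R) : R :=
  rho * ln (partition_sum R b s) - (1 - rho * b.+1%:R) * s.

(** [inf] is a true infimum only for a set bounded below, which [free_energy_ge0] provides on the
    relevant densities. *)
Definition entropy (R : realType) (b : nat) (rho : R) : R :=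
  inf (range (free_energy R b rho)).

(** Since q(x) >= 1 and q(x) >= x^b, also q(x)^n >= x^m for m between 0 and b n: the second bound
    serves x >= 1, the first x < 1. *)
Lemma ln_partition_sum_cone (R : realType) (b : nat) (n m s : R) :
  0 <= n -> 0 <= m <= b%:R * n -> 0 <= n * ln (partition_sum R b s) - m * s.
Proof.
move=> n0 /andP[m0 mn]; rewrite subr_ge0.
have Z0 : 0 <= ln (partition_sum R b s) by rewrite ln_ge0 // partition_sum_ge1.
have Zb : s * b%:R <= ln (partition_sum R b s).
  by rewrite -[leLHS]expRK ler_ln ?posrE ?expR_gt0 ?partition_sum_gt0 // partition_sum_ge_expR.
have [s0|s0] := leP 0 s.
  by apply: le_trans (ler_wpM2l n0 Zb); nra.
by apply: le_trans (mulr_ge0 n0 Z0); nra.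
Qed.

Lemma free_energy_ge0 (R : realType) (b : nat) (rho s : R) :
  1 <= rho * (2 * b + 1)%:R -> rho * b.+1%:R <= 1 -> 0 <= free_energy R b rho s.
Proof.
move=> h1 h2; apply: ln_partition_sum_cone.
  by rewrite -(pmulr_lge0 _ (_ : 0 < (2 * b + 1)%:R :> R)) ?ltr0n; [lra | lia].
by move: h1 h2; rewrite natrD natrM -natr1; lra.
Qed.

Lemma entropy_le (R : realType) (b : nat) (rho s : R) :
  1 <= rho * (2 * b + 1)%:R -> rho * b.+1%:R <= 1 ->
  entropy R b rho <= free_energy R b rho s.
Proof.
move=> h1 h2; apply: ge_inf; last by exists s.
by exists 0 => _ [t _ <-]; exact: free_energy_ge0.
Qed.

Lemma entropy_ge (R : realType) (b : nat) (rho x : R) :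
  (forall s, x <= free_energy R b rho s) -> x <= entropy R b rho.
Proof.
move=> h; apply: lb_le_inf; first by exists (free_energy R b rho 0); exists 0.
by move=> _ [s _ <-].
Qed.

Lemma ln_J_upper (R : realType) (b N L : nat) (s : R) : (0 < J b N L)%N ->
  ln (J b N L)%:R <= N.+1%:R * ln (partition_sum R b s)
                     - (L%:R + b%:R - N%:R * b.+1%:R) * s.
Proof.
rewrite J_window_coef; set m := _ - _ => P0.
have := window_coef_upper R b N.+1 m s.
rewrite -ler_ln ?posrE ?exprn_gt0 ?partition_sum_gt0 ?mulr_gt0 ?expR_gt0 ?ltr0n //.
rewrite lnM ?posrE ?expR_gt0 ?ltr0n // expRK lnXn ?partition_sum_gt0 //.
rewrite -[in X in _ <= X]mulr_natl /m !(intrB, intrD) -!pmulrn natrM; lra.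
Qed.

(** The two hypotheses amount to 0 <= m < b(N+1) for m = L + b - N(b+1), the range in which a tilt
    exists. *)
Lemma ln_J_lower (R : realType) (b N L : nat) :
  (N * b.+1 <= L + b)%N -> (L < N * (2 * b + 1))%N ->
  (0 < J b N L)%N /\ exists s : R,
  N.+1%:R * ln (partition_sum R b s) - (L%:R + b%:R - N%:R * b.+1%:R) * s
    - ln (b * N.+1).+1%:R <= ln (J b N L)%:R.
Proof.
move=> h1 h2; rewrite J_window_coef.
have -> : L%:Z + b%:Z - (N * b.+1)%:Z = (L + b - N * b.+1)%N%:Z by lia.
set m := (L + b - N * b.+1)%N.
have mn : (m < b * N.+1)%N by rewrite /m; nia.
have P0 : (0 < window_coef b N.+1 m%:Z)%N by apply: window_coef_gt0; lia.
split=> //; have [s hs] := window_coef_lower R b N.+1 m mn; exists s.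
move: hs; rewrite -ler_ln ?posrE ?exprn_gt0 ?partition_sum_gt0 ?mulr_gt0 ?expR_gt0 ?ltr0n //.
rewrite !lnM ?posrE ?mulr_gt0 ?expR_gt0 ?ltr0n // expRK lnXn ?partition_sum_gt0 //.
rewrite -[in X in X <= _]mulr_natl /m natrB // natrD natrM; lra.
Qed.

(** One tilt within e/2 of the infimum serves every L; rounding rho L costs a constant, absorbed by
    the other e/2. *)
Lemma near_complexity_seq_upper (R : realType) (b : nat) (rho e : R) :
  0 <= rho -> 1 <= rho * (2 * b + 1)%:R -> rho * b.+1%:R <= 1 -> 0 < e ->
  \forall L \near \oo%classic, complexity_seq b rho L <= entropy R b rho + e.
Proof.
move=> rho0 h1 h2 e0.
have [_ [s _ <-] hs] : exists2 y, range (free_energy R b rho) y & y < entropy R b rho + e / 2.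
  apply: inf_adherent; first lra.
  split; first by exists (free_energy R b rho 0); exists 0.
  by exists 0 => _ [t _ <-]; exact: free_energy_ge0.
set lZ := ln (partition_sum R b s).
(* With x the fractional part of rho L, the rounding error is (1-x) lZ - (b + x(b+1)) s, at most
   [C]. *)
pose C := lZ + (2 * b + 1)%:R * `|s|.
have lZ0 : 0 <= lZ by rewrite ln_ge0 // partition_sum_ge1.
near=> L.
have L0 : 0 < L%:R :> R by rewrite ltr0n; near: L; exists 1%N.
have LC : C / (e / 2) <= L%:R by near: L; exact: nbhs_infty_ger.
rewrite /complexity_seq ler_pdivrMr //.
set N := Num.truncn _.
have F0 : 0 <= entropy R b rho by apply: entropy_ge => t; exact: free_energy_ge0.
have [J0|J0] := leqP (J b N L) 0.
  by move: J0; rewrite leqn0 => /eqP ->; rewrite ln0 // mulr_ge0 //; lra.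
apply: le_trans (ln_J_upper R b N L s J0) _; rewrite -/lZ.
have /truncn_itv : 0 <= rho * L%:R by rewrite mulr_ge0 // ltW.
rewrite -/N -natr1 => /andP[N1 N2].
have e2 : 0 < e / 2 by lra.
move: LC; rewrite ler_pdivrMr //.
move: hs h1 h2; rewrite /C /free_energy -/lZ natrD natrM -(natr1 b) => hs h1 h2 LC.
have sle : - s <= `|s| by rewrite -normrN ler_norm.
set x := rho * L%:R - N%:R.
have x01 : 0 <= x < 1 by rewrite /x; lra.
have eN : N%:R = rho * L%:R - x by rewrite /x; lra.
have b0 : 0 <= b%:R :> R by [].
have t1 : (1 - x) * lZ <= lZ by nra.
have t2 : (b%:R + x * (b%:R + 1)) * - s <= (2 * b%:R + 1) * `|s|.
  apply: le_trans (_ : (b%:R + x * (b%:R + 1)) * `|s| <= _).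
    by apply: ler_wpM2l => //; nra.
  by apply: ler_wpM2r => //; nra.
have t3 := ler_wpM2r (ltW L0) (ltW hs).
rewrite eN; clearbody x; clear eN; lra.
Unshelve. all: by end_near.
Qed.

(* The defect between the integer pair (exponent n = N + 1, index m) and (1 - e) L times
   (rho, 1 - rho (b+1)) lies in the cone [0 <= m <= b n], where [n ln q(x) - m ln x] is
   nonnegative; so the optimal tilt, which depends on L, needs no bound. *)
Lemma near_complexity_seq_lower (R : realType) (b : nat) (rho e : R) :
  0 <= rho -> 1 < rho * (2 * b + 1)%:R -> rho * b.+1%:R <= 1 -> 0 < e < 1 ->
  \forall L \near \oo%classic, entropy R b rho * (1 - e) - e * (2 * b + 2)%:R
     <= complexity_seq b rho L.
Proof.
move=> rho0 h1 h2 /andP[e0 e1].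
near=> L.
have L0 : 0 < L%:R :> R by rewrite ltr0n; near: L; exists 1%N.
have L1 : 1 <= L%:R :> R by rewrite ler1n; near: L; exists 1%N.
(* This threshold makes the slack e L (rho(2b+1) - 1) at least 2b+1, enough to absorb the rounding
   of rho L. *)
have LC : (2 * b + 1)%:R / (e * (rho * (2 * b + 1)%:R - 1)) <= L%:R.
  by near: L; exact: nbhs_infty_ger.
have Le : - ln e / e <= L%:R by near: L; exact: nbhs_infty_ger.
rewrite /complexity_seq ler_pdivlMr //.
set N := Num.truncn _.
have /truncn_itv : 0 <= rho * L%:R by rewrite mulr_ge0 // ltW.
rewrite -/N -natr1 => /andP[N1 N2].
move: LC Le; rewrite !ler_pdivrMr ?mulr_gt0 ?subr_gt0 // => LC Le.
have hN1 : (N * b.+1 <= L + b)%N.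
  rewrite -(ler_nat R) natrM natrD.
  apply: le_trans (ler_wpM2r _ N1) _ => //.
  by rewrite mulrAC; apply: le_trans (ler_wpM2r (ltW L0) h2) _; rewrite mul1r lerDl.
have hN2 : (L < N * (2 * b + 1))%N.
  rewrite -(ltr_nat R) natrM.
  have := ltr_pM2r (_ : 0 < (2 * b + 1)%:R :> R) (rho * L%:R) (N%:R + 1).
  rewrite N2 ltr0n addn1 => /(_ isT).
  have : (rho * (2 * b).+1%:R - 1) * L%:R * e <= (rho * (2 * b).+1%:R - 1) * L%:R.
    apply: ler_piMr; last exact: ltW.
    by apply: mulr_ge0 => //; move: h1; rewrite addn1; lra.
  by move: LC; rewrite addn1; lra.
have [_ [s]] := ln_J_lower R b N L hN1 hN2.
apply: le_trans.
set lZ := ln (partition_sum R b s).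
set x := rho * L%:R - N%:R.
have x01 : 0 <= x < 1 by rewrite /x; lra.
have eN : N%:R = rho * L%:R - x by rewrite /x; lra.
clearbody x.
have cone : 0 <= (N.+1%:R - (1 - e) * (rho * L%:R)) * lZ
     - ((L%:R + b%:R - N%:R * b.+1%:R) - (1 - e) * L%:R * (1 - rho * b.+1%:R)) * s.
  apply: ln_partition_sum_cone.
    rewrite -(natr1 N) eN.
    have t1 : 0 <= e * (rho * L%:R) by rewrite !mulr_ge0 // ltW.
    by lra.
  rewrite -(natr1 N) eN.
  have b0 : 0 <= b%:R :> R by [].
  have t1 : 0 <= e * L%:R * (1 - rho * b.+1%:R) by rewrite !mulr_ge0 // ?subr_ge0 // ltW.
  move: t1 LC; rewrite natrD natrM -(natr1 b) => t1 LC.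
  have t2 : 0 <= x * (b%:R + 1) by nra.
  have t3 : x * (2 * b%:R + 1) <= 2 * b%:R + 1 by nra.
  by apply/andP; split; lra.
(* From 1 + ln(e y) <= e y, with y at most (2b+1) L and -ln e at most e L. *)
have lnb : ln (b * N.+1).+1%:R <= e * (2 * b + 2)%:R * L%:R.
  have y0 : 0 < (b * N.+1).+1%:R :> R by [].
  have := expR_ge1Dx (ln (e * (b * N.+1).+1%:R)).
  rewrite lnK ?posrE ?mulr_gt0 // lnM ?posrE //.
  have : e * (b * N.+1).+1%:R <= e * ((2 * b + 1)%:R * L%:R).
    rewrite ler_pM2l // -natrM ler_nat.
    have /(leq_pmulr b) bL : (0 < L)%N by rewrite -(ltr0n R).
    have N0 : (0 < N)%N by rewrite lt0n; apply/eqP => N0; rewrite N0 in hN2.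
    clear -bL N0 hN1; lia.
  by move: Le; rewrite (natrD _ (2 * b)) (natrD _ (2 * b) 2) (natrM _ 2 b); lra.
have := entropy_le R b rho s (ltW h1) h2.
rewrite -(ler_pM2l (_ : 0 < (1 - e) * L%:R)) ?mulr_gt0 ?subr_gt0 //.
rewrite /free_energy -/lZ; lra.
Unshelve. all: by end_near.
Qed.

Lemma cvg_complexity_seq_entropy (R : realType) (b : nat) (rho : R) :
  0 <= rho -> 1 < rho * (2 * b + 1)%:R -> rho * b.+1%:R <= 1 ->
  (complexity_seq b rho @ \oo --> entropy R b rho)%classic.
Proof.
move=> rho0 h1 h2; apply/cvgrPdist_le => e e0.
have F0 : 0 <= entropy R b rho.
  by apply: entropy_ge => t; apply: free_energy_ge0 => //; exact: ltW.
set K := entropy R b rho + (2 * b + 2)%:R.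
have K0 : 0 < K by rewrite ltr_wpDl // ltr0n addn2.
(* The lower bound with parameter [d] falls short of the entropy by exactly [d * K]. *)
pose d := Num.min (1 / 2) (e / K).
have d01 : 0 < d < 1.
  apply/andP; split; first by rewrite lt_min; apply/andP; split; [lra | exact: divr_gt0].
  by rewrite gt_min; apply/orP; left; lra.
have dK : d * K <= e by rewrite -ler_pdivlMr // /d ge_min lexx orbT.
near=> L.
have up : complexity_seq b rho L <= entropy R b rho + e.
  by near: L; apply: near_complexity_seq_upper => //; exact: ltW.
have lo : entropy R b rho * (1 - d) - d * (2 * b + 2)%:R <= complexity_seq b rho L.
  by near: L; exact: near_complexity_seq_lower.
by move: dK; rewrite ler_norml /K; lra.
Unshelve. all: by end_near.
Qed.

(** N(2b+1) <= L puts the index at or beyond the degree b(N+1), so [J] is 0 or 1 and every term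
    vanishes. *)
Lemma cvg_complexity_seq_low (R : realType) (b : nat) (rho : R) :
  0 <= rho -> rho * (2 * b + 1)%:R <= 1 ->
  (complexity_seq b rho @ \oo --> (0 : R))%classic.
Proof.
move=> rho0 h; rewrite (_ : complexity_seq b rho = fun=> 0); first exact: cvg_cst.
apply/funext => L; rewrite /complexity_seq; set N := Num.truncn _.
have /truncn_itv : 0 <= rho * L%:R by rewrite mulr_ge0.
rewrite -/N => /andP[N1 _].
have NL : (N * (2 * b + 1) <= L)%N.
  rewrite -(ler_nat R) natrM; apply: le_trans (ler_wpM2r _ N1) _ => //.
  by rewrite mulrAC; apply: le_trans (ler_wpM2r _ h) _; rewrite ?mul1r.
have : (J b N L <= 1)%N by rewrite J_window_coef window_coef_le1 //; lia.
by case: (J b N L) => [|[|//]] _; rewrite ?ln1 ?ln0 ?mul0r.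
Qed.

(** Eventually N(b+1) > L + b, so the index is negative and no jammed word exists; the term is then
    0 because [ln 0] is 0. *)
Lemma cvg_complexity_seq_high (R : realType) (b : nat) (rho : R) :
  1 < rho * b.+1%:R -> (complexity_seq b rho @ \oo --> (0 : R))%classic.
Proof.
move=> h; apply/cvgrPdist_le => e e0; near=> L.
have LC : (2 * b + 1)%:R / (rho * b.+1%:R - 1) <= L%:R.
  by near: L; exact: nbhs_infty_ger.
rewrite /complexity_seq; set N := Num.truncn _.
have N2 : rho * L%:R < N%:R + 1 by rewrite natr1; exact: truncnS_gt.
move: LC; rewrite ler_pdivrMr ?subr_gt0 // => LC.
have NL : (L + b < N * b.+1)%N.
  rewrite -(ltr_nat R) natrD natrM.
  have := ltr_pM2r (_ : 0 < b.+1%:R :> R) (rho * L%:R) (N%:R + 1).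
  rewrite N2 ltr0n => /(_ isT).
  by move: LC; rewrite natrD natrM -(natr1 b); lra.
have -> : J b N L = 0%N by rewrite J_window_coef window_coef_lt0 //; lia.
by rewrite ln0 // mul0r subr0 normr0 ltW.
Unshelve. all: by end_near.
Qed.

Lemma cvg_complexity_seq_out (R : realType) (b : nat) (rho : R) : 0 <= rho ->
  ~~ (1 < rho * (2 * b + 1)%:R) || ~~ (rho * b.+1%:R <= 1) ->
  (complexity_seq b rho @ \oo --> (0 : R))%classic.
Proof.
move=> rho0; rewrite -leNgt -ltNge => /orP[|].
  exact: cvg_complexity_seq_low.
exact: cvg_complexity_seq_high.
Qed.

(** * Location of the maximum *)

(** exp(y) <= 1/(1-y), and (1-y)(1 + y + 2y^2) = 1 + y^2 (1-2y) >= 1. *)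
Lemma expR_le_quadratic (R : realType) (y : R) : y <= 1 / 2 ->
  expR y <= 1 + y + 2 * y ^+ 2.
Proof.
move=> y2; have y1 : 0 < 1 - y by lra.
have := expR_ge1Dx (- y); rewrite expRN => h.
have : (1 - y) * expR y <= 1 by rewrite -ler_pdivlMr ?expR_gt0 // mul1r.
move=> h1; rewrite -(ler_pM2l y1); apply: le_trans h1 _.
have : 0 <= y ^+ 2 * (1 - 2 * y) by rewrite mulr_ge0 ?sqr_ge0 //; lra.
by rewrite !expr2; lra.
Qed.

Lemma partition_sum_tilt (R : realType) (b : nat) (c s t : R) :
  partition_sum R b (s + t) * expR (- (c * t)) =
  \sum_(i < b.+1) expR (s * i%:R) * expR ((i%:R - c) * t).
Proof.
rewrite /partition_sum mulr_suml; apply: eq_bigr => i _.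
by rewrite -!expRD; congr expR; ring.
Qed.

(* [c] is 1/rho - (b+1), the mean excess at density rho. *)
Lemma free_energyD (R : realType) (b : nat) (rho c s t : R) :
  1 - rho * b.+1%:R = rho * c ->
  free_energy R b rho (s + t) =
  rho * ln (\sum_(i < b.+1) expR (s * i%:R) * expR ((i%:R - c) * t)) - rho * c * s.
Proof.
move=> hc; rewrite -partition_sum_tilt lnM ?posrE ?expR_gt0 ?partition_sum_gt0 //.
by rewrite expRK /free_energy hc; ring.
Qed.

(** Each exponential lies above its tangent 1 + (i-c)u, and the linear terms cancel because the mean
    excess at tilt [s] is [c]. *)
Lemma free_energy_min (R : realType) (b : nat) (rho c s t : R) :
  0 < rho -> 1 - rho * b.+1%:R = rho * c ->
  \sum_(i < b.+1) expR (s * i%:R) * (i%:R - c) = 0 ->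
  free_energy R b rho s <= free_energy R b rho t.
Proof.
move=> rho0 hc D0; rewrite -(subrKC s t) (free_energyD _ _ _ _ _ _ hc).
rewrite /free_energy hc lerD2r ler_pM2l // ler_ln ?posrE ?partition_sum_gt0 //; last first.
  by rewrite -partition_sum_tilt mulr_gt0 ?expR_gt0 ?partition_sum_gt0.
set u := t - s.
have <- : \sum_(i < b.+1) expR (s * i%:R) * (1 + (i%:R - c) * u) = partition_sum R b s.
  rewrite -[RHS]addr0 -[X in _ + X](mul0r u) -[X in X * u]D0 mulr_suml /partition_sum.
  by rewrite -big_split; apply: eq_bigr => i _ /=; ring.
by apply: ler_sum => i _; rewrite ler_pM2l ?expR_gt0 // expR_ge1Dx.
Qed.

(** [D] is the slope at [s] of the tilted sum; a small step against its sign wins over the quadratic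
    error. *)
Lemma free_energy_not_min (R : realType) (b : nat) (rho c s : R) :
  0 < rho -> 1 - rho * b.+1%:R = rho * c -> 0 <= c <= b%:R ->
  \sum_(i < b.+1) expR (s * i%:R) * (i%:R - c) != 0 ->
  exists t, free_energy R b rho t < free_energy R b rho s.
Proof.
move=> rho0 hc cb; set D := \sum_(i < _) _ => D0.
set Z := partition_sum R b s.
have Z0 : 0 < Z by exact: partition_sum_gt0.
have icb (i : 'I_b.+1) : `|i%:R - c| <= b%:R.
  have : i%:R <= b%:R :> R by rewrite ler_nat -ltnS.
  have : 0 <= i%:R :> R by [].
  by rewrite ler_norml; lra.
have DZ : `|D| <= b%:R * Z.
  rewrite mulrC /Z /partition_sum mulr_suml; apply: le_trans (ler_norm_sum _ _ _) _.
  apply: ler_sum => i _; rewrite normrM ger0_norm ?expR_ge0 //.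
  by rewrite ler_pM2l ?expR_gt0.
have b0 : 0 < b%:R :> R.
  rewrite ltr0n lt0n; apply/eqP => b0; move: DZ.
  by rewrite b0 mul0r normr_le0 (negbTE D0).
(* The step [- D / A] minimizes D u + 2 b^2 Z u^2, and |D| <= b Z keeps it within reach of the
   quadratic bound. *)
pose A := 4 * b%:R ^+ 2 * Z.
have A0 : 0 < A by rewrite !mulr_gt0 ?exprn_gt0.
pose u := - D / A; exists (s + u).
rewrite (free_energyD _ _ _ _ _ _ hc) /free_energy hc ltrD2r ltr_pM2l //.
rewrite ltr_ln ?posrE ?partition_sum_gt0 //; last first.
  by rewrite -partition_sum_tilt mulr_gt0 ?expR_gt0 ?partition_sum_gt0.
have bu : b%:R * `|u| <= 1 / 2.
  rewrite /u normrM normrN normfV (gtr0_norm A0) mulrA ler_pdivrMr //.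
  apply: le_trans (ler_wpM2l (ltW b0) DZ) _.
  have := mulr_gt0 (mulr_gt0 b0 b0) Z0.
  by rewrite /A expr2; lra.
apply: (@le_lt_trans _ _ (Z + D * u + 2 * b%:R ^+ 2 * u ^+ 2 * Z)).
  have -> : Z + D * u + 2 * b%:R ^+ 2 * u ^+ 2 * Z =
    \sum_(i < b.+1) expR (s * i%:R) *
      (1 + (i%:R - c) * u + 2 * (b%:R ^+ 2 * u ^+ 2)).
    rewrite /Z /D /partition_sum mulr_suml mulr_sumr -!big_split /=.
    by apply: eq_bigr => i _; ring.
  apply: ler_sum => i _; rewrite ler_pM2l ?expR_gt0 //.
  have iu : `|(i%:R - c) * u| <= b%:R * `|u| by rewrite normrM ler_wpM2r.
  apply: le_trans (expR_le_quadratic _ _ _) _.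
    by apply: le_trans (ler_norm _) _; exact: le_trans iu bu.
  rewrite lerD2l ler_pM2l // -exprMn -real_normK ?num_real // -[leRHS]real_normK ?num_real //.
  by rewrite ler_sqr ?nnegrE // [leRHS]normrM (gtr0_norm b0).
rewrite -addrA gtrDl.
have -> : D * u + 2 * b%:R ^+ 2 * u ^+ 2 * Z = - (D ^+ 2 / (2 * A)).
  rewrite /u /A; field; rewrite ?(gt_eqF b0) ?(gt_eqF Z0) //.
rewrite oppr_lt0; apply: divr_gt0; last exact: mulr_gt0.
by rewrite lt0r sqrf_eq0 D0 sqr_ge0.
Qed.

(** * The root z and the closed form of the density *)

Lemma rydberg_polyE (R : realType) (b : nat) (x : R) :
  (rydberg_poly R b).[x] = x ^+ b.+1 * (\sum_(i < b.+1) x ^+ i) - 1.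
Proof.
rewrite /rydberg_poly hornerD hornerN hornerC horner_sum; congr (_ - _).
rewrite -[b.+1 in LHS]add0n big_addn (_ : (2 * b + 1).+1 - b.+1 = b.+1)%N; last lia.
rewrite big_mkord mulr_sumr; apply: eq_bigr => i _.
by rewrite hornerXn exprD mulrC.
Qed.

(** The polynomial is -1 at 0, b at 1, and strictly increasing on positive reals. *)
Lemma rydberg_poly_unique_root (R : realType) (b : nat) : (0 < b)%N ->
  exists z : R, unique (fun x : R => 0 < x < 1 /\ root (rydberg_poly R b) x) z.
Proof.
move=> b0.
have p0 : (rydberg_poly R b).[0] = -1 by rewrite rydberg_polyE expr0n mul0r sub0r.
have p1 : 0 < (rydberg_poly R b).[1].
  rewrite rydberg_polyE expr1n mul1r (eq_bigr (fun=> 1)) => [|i _]; last exact: expr1n.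
  by rewrite sumr_const card_ord -natr1 addrK ltr0n.
have [|z z01 rz] := @poly_ivt R (rydberg_poly R b) 0 1 ler01.
  by rewrite p0 lerN10 ltW.
have lt01 x : 0 <= x <= 1 -> root (rydberg_poly R b) x -> 0 < x < 1.
  move=> /andP[x0 x1] /rootP px; rewrite !lt_neqAle x0 x1 !andbT.
  apply/andP; split; apply/eqP => xe.
    by move: px; rewrite -xe p0 => /eqP; rewrite oppr_eq0 oner_eq0.
  by move: p1; rewrite -xe px ltxx.
have mono x y : 0 < x -> x < y -> (rydberg_poly R b).[x] < (rydberg_poly R b).[y].
  move=> x0 xy; rewrite !rydberg_polyE ltrD2r.
  apply: ltr_pM.
  - by rewrite exprn_ge0 // ltW.
  - by apply: sumr_ge0 => i _; rewrite exprn_ge0 // ltW.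
  - by rewrite ltrXn2r // ltW.
  rewrite big_ord_recr [ltRHS]big_ord_recr /=; apply: ler_ltD.
    by apply: ler_sum => i _; rewrite lerXn2r ?nnegrE ?ltW // (lt_trans x0).
  by rewrite ltrXn2r ?ltW //; lia.
exists z; split; first by split => //; exact: lt01.
move=> y [/andP[y0 y1] /rootP py]; have /andP[z0 _] := lt01 _ z01 rz.
move/rootP: rz => pz; case: (ltgtP z y) => // [zy|yz].
- by have := mono _ _ z0 zy; rewrite pz py ltxx.
- by have := mono _ _ y0 yz; rewrite pz py ltxx.
Qed.

(** The sum is z q'(z) when n = b. *)
Lemma sum_expr_index (R : realType) (n : nat) (z : R) :
  (1 - z) ^+ 2 * (\sum_(i < n.+1) z ^+ i * i%:R) =
  z * (1 - n.+1%:R * z ^+ n + n%:R * z ^+ n.+1).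
Proof.
elim: n => [|n IH]; first by rewrite big_ord1 expr0 mulr0 mul0r mulr1 subrr addr0 !mulr0.
by rewrite big_ord_recr /= mulrDr IH -!natr1 !exprS; ring.
Qed.

(** Cancelling (1-z)^2 turns the closed form into the stationarity condition rho (b + 1 + z
    q'(z)/q(z)) = 1. *)
Lemma rho_starE (R : realType) (b : nat) (z : R) : z < 1 ->
  rho_star b z = (\sum_(i < b.+1) z ^+ i) /
    (b.+1%:R * (\sum_(i < b.+1) z ^+ i) + \sum_(i < b.+1) z ^+ i * i%:R).
Proof.
move=> z1; have z10 : (1 - z) ^+ 2 != 0 by rewrite sqrf_eq0; lra.
set q := \sum_(i < _) z ^+ i; set q1 := \sum_(i < _) z ^+ i * _.
have qE : (1 - z) * q = 1 - z ^+ b.+1 by rewrite -opprB mulNr -subrX1 opprB.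
have q1E := sum_expr_index R b z; rewrite -/q1 in q1E.
rewrite -[RHS](mulKf z10) /rho_star.
rewrite (_ : (1 - z) * (1 - z ^+ (b + 1)) = (1 - z) ^+ 2 * q); last first.
  by rewrite addn1 -qE; ring.
rewrite (_ : 1 + _ - _ - _ - _ + _ + _ = (1 - z) ^+ 2 * (b.+1%:R * q + q1)); last first.
  have -> : (1 - z) ^+ 2 * (b.+1%:R * q + q1) =
    b.+1%:R * (1 - z) * ((1 - z) * q) + (1 - z) ^+ 2 * q1 by ring.
  by rewrite qE q1E -!natr1 addn1 addn2 !exprS; ring.
by rewrite -mulf_div divff // mul1r mulKf.
Qed.

Lemma partition_sum_ln (R : realType) (b : nat) (z : R) : 0 < z ->
  partition_sum R b (ln z) = \sum_(i < b.+1) z ^+ i.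
Proof.
move=> z0; apply: eq_bigr => i _.
by rewrite expRM_natr lnK.
Qed.

Lemma free_energy_ln_root (R : realType) (b : nat) (rho z : R) :
  0 < z -> root (rydberg_poly R b) z -> free_energy R b rho (ln z) = - ln z.
Proof.
move=> z0 /rootP; rewrite rydberg_polyE -partition_sum_ln // => /eqP.
rewrite subr_eq0 => /eqP /(congr1 (@ln R)).
rewrite lnM ?posrE ?exprn_gt0 ?partition_sum_gt0 // lnXn // ln1 -mulr_natl => h.
have lnZ : ln (partition_sum R b (ln z)) = - (b.+1%:R * ln z) by lra.
by rewrite /free_energy lnZ; ring.
Qed.

Theorem theorem3p2 (R : realType) (b : nat) (hb : (1 <= b)%N) :
  (forall rho : R, 0 <= rho <= 1 -> cvgn (complexity_seq b rho)) /\
  exists z : R,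
    [/\ unique (fun x : R => 0 < x < 1 /\ root (rydberg_poly R b) x) z,
        0 <= rho_star b z <= 1
      & forall rho : R, 0 <= rho <= 1 -> rho != rho_star b z ->
          complexity b rho < complexity b (rho_star b z)].
Proof.
have inside (rho : R) : 0 <= rho -> 1 < rho * (2 * b + 1)%:R -> rho * b.+1%:R <= 1 ->
    complexity b rho = entropy R b rho.
  by move=> *; apply: cvg_lim; [exact: norm_hausdorff | exact: cvg_complexity_seq_entropy].
have outside (rho : R) : 0 <= rho ->
    ~~ (1 < rho * (2 * b + 1)%:R) || ~~ (rho * b.+1%:R <= 1) -> complexity b rho = 0.
  by move=> *; apply: cvg_lim; [exact: norm_hausdorff | exact: cvg_complexity_seq_out].
split.
  move=> rho /andP[rho0 _]; apply/cvg_ex.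
  case: (boolP ((1 < rho * (2 * b + 1)%:R) && (rho * b.+1%:R <= 1))).
    by move=> /andP[h1 h2]; exists (entropy R b rho); exact: cvg_complexity_seq_entropy.
  by rewrite negb_and => h; exists 0; exact: cvg_complexity_seq_out.
have [z uz] := rydberg_poly_unique_root R b hb; exists z.
have [[/andP[z0 z1] rz] _] := uz.
set q := \sum_(i < b.+1) z ^+ i; set q1 := \sum_(i < b.+1) z ^+ i * i%:R.
have rsE : rho_star b z = q / (b.+1%:R * q + q1) by exact: rho_starE.
have q0 : 0 < q by rewrite /q -partition_sum_ln // partition_sum_gt0.
have q10 : 0 <= q1 by apply: sumr_ge0 => i _; rewrite mulr_ge0 // exprn_ge0 // ltW.
(* Strict through the term i = 0, where b > 0; this puts [rs] strictly above 1/(2b+1). *)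
have q1b : q1 < b%:R * q.
  rewrite /q1 /q mulr_sumr big_ord_recl [ltRHS]big_ord_recl /= expr0 !mulr0 mulr1.
  apply: ltr_leD; first by rewrite ltr0n.
  apply: ler_sum => i _; rewrite mulrC ler_wpM2r ?exprn_ge0 ?(ltW z0) //.
  by rewrite ler_nat; have := ltn_ord i.
set rs := rho_star b z in rsE *.
have D0 : 0 < b.+1%:R * q + q1 by rewrite ltr_pwDl // mulr_gt0.
have rs0 : 0 < rs by rewrite rsE divr_gt0.
have rs1 : 1 < rs * (2 * b + 1)%:R.
  rewrite rsE mulrAC ltr_pdivlMr // mul1r natrD natrM -(natr1 b); lra.
have rs2 : rs * b.+1%:R <= 1.
  rewrite rsE mulrAC ler_pdivrMr // mul1r; lra.
have tilt (c : R) : \sum_(i < b.+1) expR (ln z * i%:R) * (i%:R - c) = q1 - c * q.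
  rewrite /q1 /q mulr_sumr -sumrB; apply: eq_bigr => i _.
  by rewrite expRM_natr lnK //; ring.
have lnz : ln z < 0 by rewrite ln_lt0 // z0.
(* The mean excess at [rs] is q1/q, exactly the one of the tilt ln z. *)
have max_rs : - ln z <= complexity b rs.
  rewrite inside ?(ltW rs0) //; apply: entropy_ge => s.
  rewrite -(free_energy_ln_root R b rs z z0 rz).
  apply: (free_energy_min _ _ _ (q1 / q)) => //.
    rewrite rsE; field; apply/andP; split; lra.
  by rewrite tilt; field; lra.
split=> //.
  rewrite ltW //=; apply: le_trans rs2.
  by rewrite ler_peMr ?ler1n // ltW.
move=> rho /andP[rho0 rho1] rho_ne; apply: lt_le_trans max_rs.
case: (boolP ((1 < rho * (2 * b + 1)%:R) && (rho * b.+1%:R <= 1))); last first.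
  (* Outside the density window the complexity is 0, while -ln z > 0. *)
  by rewrite negb_and => h; rewrite outside // oppr_gt0.
move=> /andP[h1 h2]; rewrite inside //.
have rho_gt0 : 0 < rho.
  by rewrite lt_neqAle rho0 andbT; apply/eqP => e; move: h1; rewrite -e mul0r ltr10.
pose c := (1 - rho * b.+1%:R) / rho.
have hc : 1 - rho * b.+1%:R = rho * c by rewrite /c mulrCA divff ?mulr1 ?gt_eqF.
have cb : 0 <= c <= b%:R.
  rewrite /c divr_ge0 ?subr_ge0 //= ler_pdivrMr //.
  by move: h1; rewrite natrD natrM -(natr1 b); lra.
clearbody c.
(* Stationarity at ln z would mean q1 = c q, which forces [rho] to equal [rs]. *)
have [|t ht] := free_energy_not_min R b rho c (ln z) rho_gt0 hc cb.
  rewrite tilt subr_eq0; apply: contra rho_ne => /eqP hq.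
  have hd : rho * (b.+1%:R * q + q1) = q by rewrite hq mulrDr !mulrA -hc; ring.
  by apply/eqP; rewrite rsE; exact: (canRL (mulfK (lt0r_neq0 D0))).
apply: le_lt_trans (entropy_le R b rho t (ltW h1) h2) _.
by rewrite -(free_energy_ln_root R b rho z z0 rz).
Qed.
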